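(* Let $\varepsilon=1/N$, $x=yN$ and $y=p+\eta\sqrt{2pq\varepsilon}$. For $n=O(1)$ and $\eta=O(1)$ (so that $y-p=O(\varepsilon^{1/2})$), as $N\to\infty$, $$K_n(x)\sim\frac{\varepsilon^{-n/2}}{n!}\left(\frac{pq}{2}\right)^{n/2}H_n(\eta).$$
   Context: Fix real $0<p,q<1$ with $p+q=1$. For integers $n,N\ge 0$ and real $x$, the Krawtchouk polynomial is $$K_n(x)=K_n(x,N,p,q)=\sum_{k=0}^{n}\binom{x}{k}\binom{N-x}{n-k}q^{k}(-p)^{n-k},$$ where $\binom{a}{k}=a(a-1)\cdots(a-k+1)/k!$ for real $a$ and integer $k\geq 0$. $H_n$ is the (physicists') Hermite polynomial of degree $n$: $H_0=1$, $H_1(\eta)=2\eta$, $H_{n+1}(\eta)=2\eta H_n(\eta)-2nH_{n-1}(\eta)$.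
   Formalization: As a ratio, ''~'' fails at zeros of H_n (e.g. n=3, η=0, p≠q: right side 0, K_3≠0); proved instead: K_n(x) equals ε^{-n/2}/n!·(pq/2)^{n/2}·(H_n(η)+o(1)) for all bounded n, η, and ''~'' holds literally when |H_n(η)| stays bounded away from 0. *)

(* Defs.v *)
From HB Require Import structures.
From mathcomp Require Import all_boot all_order all_algebra.
From mathcomp Require Import all_classical all_reals all_analysis.

Set Implicit Arguments.
Unset Strict Implicit.
Unset Printing Implicit Defensive.

Import Order.TTheory GRing.Theory Num.Theory.
Import numFieldNormedType.Exports.

Local Open Scope ring_scope.

(* Binomial coefficient with a real upper argument. *)
Definition rbinom (R : realType) (a : R) (k : nat) : R :=
  (\prod_(i < k) (a - i%:R)) / k`!%:R.

Definition krawtchouk (R : realType) (n N : nat) (p q x : R) : R :=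
  \sum_(k < n.+1)
    rbinom x k * rbinom (N%:R - x) (n - k) * q ^+ k * (- p) ^+ (n - k).

(* Physicists' normalization; in the recursive case m = n - 1, so the
   recurrence reads H_{n+1} = 2 x H_n - 2 n H_{n-1}. *)
Fixpoint hermite (R : realType) (d : nat) (x : R) : R :=
  match d with
  | 0 => 1
  | n.+1 =>
    match n with
    | 0 => 2 * x
    | m.+1 => 2 * x * hermite n x - 2 * n%:R * hermite m x
    end
  end.

(* Main.v *)
Require Import Defs.
From HB Require Import structures.
From mathcomp Require Import all_boot all_order all_algebra.
From mathcomp Require Import all_classical all_reals all_analysis.
From mathcomp Require Import ring lra.

Set Implicit Arguments.
Unset Strict Implicit.
Unset Printing Implicit Defensive.

Import Order.TTheory GRing.Theory Num.Theory.
Import numFieldNormedType.Exports.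

Local Open Scope classical_set_scope.
Local Open Scope ring_scope.

(** Krawtchouk polynomials satisfy a three-term recurrence in the degree
    (lemma krawtchoukSS).  Put a = sqrt (p q N / 2), so that the argument is
    x = p N + 2 a eta, and divide K_m by a^m / m!, which is the factor
    eps^(-m/2) / m! * (p q / 2)^(m/2) of the statement (lemma
    powR_half_scale).  The quotients L_m then satisfy
      L_{m+2} = (2 eta - (m+1) (q-p) / a) L_{m+1}
                - (m+1) (2 - m p q / a^2) L_m,
    with L_0 = 1 and L_1 = 2 eta, which is the Hermite recurrence up to terms
    of order 1 / a.  For a fixed range of degrees and eta in a bounded set, an
    induction on the degree gives L_m = H_m(eta) + O(1 / a) with one constant
    (lemma perturbed_hermite), hence
      K_m = a^m / m! * (H_m(eta) + O(N^(-1/2))).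
    The uniformity of the constant is what lets n and eta vary with N.  If
    H_n(eta) stays away from 0, the error is also small relative to H_n(eta),
    which is the asymptotic equivalence. *)

Lemma rbinomS (R : realType) (a : R) (k : nat) :
  k.+1%:R * rbinom a k.+1 = (a - k%:R) * rbinom a k.
Proof.
rewrite /rbinom big_ord_recr /= factS natrM invfM.
have : k.+1%:R != 0 :> R by rewrite pnatr_eq0.
by move: (k.+1%:R : R) => w w0; rewrite mulrCA (mulrA w) mulfV //; ring.
Qed.

Lemma rbinom0 (R : realType) (a : R) : rbinom a 0 = 1.
Proof. by rewrite /rbinom big_ord0 divr1. Qed.

(** The hypotheses say that the generating functions A and B of a and b satisfy
    (1 + u w) A' = u s A and (1 + v w) B' = v t B, as (1 + u w)^s and
    (1 + v w)^t do.  So the generating function C = A B satisfies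
      (1 + u w) (1 + v w) C' = (u s + v t + u v (s + t) w) C,
    and the recurrence compares the coefficients on both sides. *)
Lemma convolution_rec (R : comNzRingType) (a b : nat -> R) (s t u v : R) :
  (forall k, k.+1%:R * a k.+1 = u * (s - k%:R) * a k) ->
  (forall k, k.+1%:R * b k.+1 = v * (t - k%:R) * b k) ->
  let c n := \sum_(k < n.+1) a k * b (n - k)%N in
  forall n, n.+2%:R * c n.+2 =
    (u * s + v * t - n.+1%:R * (u + v)) * c n.+1
    + u * v * (s + t - n%:R) * c n.
Proof.
move=> Ha Hb c.
(* F and G are the coefficients of w A' B and w A B' *)
pose F n := \sum_(k < n.+1) k%:R * a k * b (n - k)%N.
pose G n := \sum_(k < n.+1) (n - k)%:R * a k * b (n - k)%N.
have cE n : n%:R * c n = F n + G n.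
  rewrite mulr_sumr -big_split /=; apply: eq_bigr => k _.
  by rewrite natrB ?leq_ord //; ring.
have FS n : F n.+1 = u * (s * c n - F n).
  rewrite {1}/F big_ord_recl /= !mul0r add0r mulr_sumr -sumrB mulr_sumr.
  by apply: eq_bigr => k _; rewrite /bump leq0n add1n subSS Ha; ring.
have GS n : G n.+1 = v * (t * c n - G n).
  rewrite {1}/G big_ord_recr /= subnn !mul0r addr0 mulr_sumr -sumrB mulr_sumr.
  apply: eq_bigr => k _; rewrite subSn ?leq_ord // mulrAC Hb; ring.
move=> n; rewrite cE (FS n.+1) (GS n.+1).
have -> : u * (s * c n.+1 - F n.+1) + v * (t * c n.+1 - G n.+1) =
  (u * s + v * t) * c n.+1 - (u + v) * (F n.+1 + G n.+1)
  + (v * F n.+1 + u * G n.+1) by ring.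
rewrite -cE FS GS.
have -> : v * (u * (s * c n - F n)) + u * (v * (t * c n - G n)) =
  u * v * ((s + t) * c n - (F n + G n)) by ring.
by rewrite -cE; ring.
Qed.

Lemma krawtchouk0 (R : realType) (N : nat) (p q x : R) :
  krawtchouk 0 N p q x = 1.
Proof. by rewrite /krawtchouk big_ord1 !rbinom0 !expr0 !mulr1. Qed.

Lemma krawtchouk1 (R : realType) (N : nat) (p q x : R) : p + q = 1 ->
  krawtchouk 1 N p q x = x - p * N%:R.
Proof.
move=> pq1; have rb1 (a : R) : rbinom a 1 = a.
  by rewrite -[LHS]mul1r (rbinomS a 0) rbinom0 subr0 mulr1.
rewrite /krawtchouk !big_ord_recr big_ord0 /= add0r !subnn !subn0 !rb1 !rbinom0.
rewrite (_ : q = 1 - p); last by rewrite -pq1; ring.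
by ring.
Qed.

Lemma krawtchoukSS (R : realType) (n N : nat) (p q x : R) : p + q = 1 ->
  n.+2%:R * krawtchouk n.+2 N p q x =
    (x - p * N%:R - n.+1%:R * (q - p)) * krawtchouk n.+1 N p q x
    - p * q * (N%:R - n%:R) * krawtchouk n N p q x.
Proof.
move=> pq1.
have Hgen (w z : R) k : k.+1%:R * (rbinom z k.+1 * w ^+ k.+1) =
    w * (z - k%:R) * (rbinom z k * w ^+ k).
  by rewrite mulrA rbinomS exprS; ring.
have KE m : krawtchouk m N p q x = \sum_(k < m.+1)
    (rbinom x k * q ^+ k) * (rbinom (N%:R - x) (m - k) * (- p) ^+ (m - k)).
  by apply: eq_bigr => k _; ring.
rewrite !KE (convolution_rec (Hgen q x) (Hgen (- p) (N%:R - x))).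
rewrite (_ : q = 1 - p); last by rewrite -pq1; ring.
by ring.
Qed.

(** Terms of order r in the coefficients of the Hermite recurrence move the
    solution by O(r), uniformly for e in a bounded set and for finitely many
    degrees.  The Hermite values are bounded along with the error because, in
    the induction, they multiply the perturbation of the coefficients. *)
Lemma perturbed_hermite (R : realType) (B d c : R) (M : nat) :
  exists2 C : R, 0 <= C &
  forall (e r : R) (L : nat -> R), `|e| <= B -> `|r| <= 1 ->
    L 0 = 1 -> L 1 = 2 * e ->
    (forall m, L m.+2 = (2 * e - m.+1%:R * d * r) * L m.+1
                        - m.+1%:R * (2 - m%:R * c * r ^+ 2) * L m) ->
  forall m, (m <= M)%N ->
    `|L m - hermite m e| <= C * `|r| /\ `|hermite m e| <= C.
Proof.
(* For negative B no e satisfies the bound *)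
have [B0|B0] := leP 0 B; last first.
  exists 0 => // e r L eB; have := normr_ge0 e; lra.
elim: M => [|M [C C0 IH]].
  exists 1 => // e r L _ _ L0 _ _ [|//] _.
  by rewrite L0 /= subrr normr0 normr1 mul1r.
case: M IH => [|M] IH.
  exists (1 + 2 * B) => [|e r L eB r1 L0 L1 _ [|[|//]] _]; first lra.
    rewrite L0 /= subrr normr0 normr1; split; last lra.
    by rewrite mulr_ge0 //; lra.
  rewrite L1 /= subrr normr0 normrM ger0_norm //; split; last lra.
  by rewrite mulr_ge0 //; lra.
(* The summands in B and 2 * M.+1 bound hermite M.+2 and, times |r|, carry over the
   errors at M.+1 and M; those in d and c, times |r|, bound the perturbation of
   the coefficients acting on L, since |L k| <= C + C. *)
pose D := C + (2 * (B * C) + 2 * (M.+1%:R * C))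
  + (M.+1%:R * `|d| * (C + C) + M.+1%:R * M%:R * `|c| * (C + C)).
have H1 : 0 <= B * C by rewrite mulr_ge0.
have H2 : 0 <= M.+1%:R * C by rewrite mulr_ge0.
have H3 : 0 <= M.+1%:R * `|d| * (C + C) by rewrite !mulr_ge0 ?addr_ge0.
have H4 : 0 <= M.+1%:R * M%:R * `|c| * (C + C).
  by rewrite !mulr_ge0 ?addr_ge0.
exists D => [|e r L eB r1 L0 L1 Lrec m]; first by rewrite /D; lra.
have {}IH := IH e r L eB r1 L0 L1 Lrec.
have CD : C <= D by rewrite /D; lra.
rewrite leq_eqVlt ltnS => /predU1P[->|mM]; last first.
  have [h1 h2] := IH m mM; split; last exact: le_trans CD.
  by apply: le_trans h1 _; rewrite ler_wpM2r.
have [u1 g1] := IH M.+1 (leqnn _); have [u0 g0] := IH M (leqnSn _).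
set h := @hermite R in u1 u0 g1 g0 *.
have hE : h M.+2 e = 2 * e * h M.+1 e - 2 * M.+1%:R * h M e.
  by [].
have r0 := normr_ge0 r.
have Lb k : `|L k - h k e| <= C * `|r| -> `|h k e| <= C -> `|L k| <= C + C.
  move=> a1 a2; rewrite -(subrK (h k e) (L k)).
  apply: le_trans (ler_normD _ _) (lerD _ a2).
  by apply: le_trans a1 _; rewrite ler_piMr.
split; last first.
  rewrite -/h hE; apply: le_trans (ler_normB _ _) _.
  rewrite !normrM !(ger0_norm (ler0n _ _)).
  have : `|e| * `|h M.+1 e| <= B * C by rewrite ler_pM.
  have : M.+1%:R * `|h M e| <= M.+1%:R * C by rewrite ler_wpM2l.
  by rewrite /D; lra.
have -> : L M.+2 - h M.+2 e = (2 * e * (L M.+1 - h M.+1 e)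
  - 2 * M.+1%:R * (L M - h M e)) + (- (M.+1%:R * d * r) * L M.+1
  + M.+1%:R * M%:R * c * r ^+ 2 * L M).
  by rewrite Lrec hE; ring.
have t1 : `|2 * e * (L M.+1 - h M.+1 e)| <= 2 * (B * C) * `|r|.
  rewrite !normrM (ger0_norm (ler0n _ 2)) -!mulrA ler_wpM2l //.
  by rewrite ler_pM.
have t2 : `|2 * M.+1%:R * (L M - h M e)| <= 2 * (M.+1%:R * C) * `|r|.
  by rewrite !normrM !(ger0_norm (ler0n _ _)) -!mulrA !ler_wpM2l.
have t3 : `|- (M.+1%:R * d * r) * L M.+1| <= M.+1%:R * `|d| * (C + C) * `|r|.
  rewrite normrM normrN !normrM (ger0_norm (ler0n _ _)) [leRHS]mulrAC.
  by rewrite ler_wpM2l ?mulr_ge0 //; apply: Lb.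
have t4 : `|M.+1%:R * M%:R * c * r ^+ 2 * L M|
    <= M.+1%:R * M%:R * `|c| * (C + C) * `|r|.
  rewrite !normrM !(ger0_norm (ler0n _ _)) [leRHS]mulrAC.
  rewrite ler_pM ?mulr_ge0 //; last exact: Lb.
  by rewrite ler_wpM2l ?mulr_ge0 // ler_piMr.
have Cr : 0 <= C * `|r| by rewrite mulr_ge0.
apply: le_trans (ler_normD _ _) _.
apply: le_trans (lerD (ler_normB _ _) (ler_normD _ _)) _.
apply: le_trans (lerD (lerD t1 t2) (lerD t3 t4)) _.
by rewrite -!mulrDl ler_wpM2r // /D; lra.
Qed.

(** A quantitative form of the asymptotics: the error is O(1 / a) relative to
    the scale a^m / m!, with a constant depending only on p, q, the bound on e
    and the bound on m. *)
Lemma krawtchouk_hermite_error (R : realType) (p q B : R) (M : nat) :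
  0 < p -> 0 < q -> p + q = 1 ->
  exists2 C : R, 0 <= C & forall (N : nat) (e : R), `|e| <= B ->
  forall a : R, a ^+ 2 = p * q / 2 * N%:R -> 1 <= a ->
  forall m, (m <= M)%N ->
    `|krawtchouk m N p q (p * N%:R + 2 * a * e) - a ^+ m / m`!%:R * hermite m e|
    <= C / a * (a ^+ m / m`!%:R).
Proof.
move=> p0 q0 pq1.
have [C C0 HC] := perturbed_hermite B (q - p) (p * q) M.
exists C => // N e eB a a2 a1 m mM.
have a0 : 0 < a by lra.
pose K k := krawtchouk k N p q (p * N%:R + 2 * a * e).
pose s k := a ^+ k / k`!%:R.
have s0 k : 0 < s k by rewrite divr_gt0 ?exprn_gt0 ?ltr0n ?fact_gt0.
have sS k : k.+1%:R * s k.+1 = a * s k.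
  rewrite /s factS natrM invfM exprS.
  have : k.+1%:R != 0 :> R by rewrite pnatr_eq0.
  move: (k.+1%:R : R) => w w0.
  by rewrite mulrCA (mulrA w) mulfV //; ring.
pose L k := K k / s k.
have KE k : K k = L k * s k by rewrite /L divfK // gt_eqF.
have [||||] := HC e a^-1 L eB _ _ _ _ m mM.
- by rewrite gtr0_norm ?invr_gt0 // invf_le1.
- by rewrite /L /K krawtchouk0 /s expr0 fact0 !divr1.
- rewrite /L /K krawtchouk1 // /s expr1 divr1.
  have an0 : a != 0 by rewrite gt_eqF.
  by field.
(* Multiplying by (k+2) s_{k+2} = a s_{k+1} turns the perturbed recurrence for L
   into the recurrence for K. *)
- move=> k; apply: (mulIf (lt0r_neq0 (s0 k.+2))).
  have k2 : k.+2%:R != 0 :> R by rewrite pnatr_eq0.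
  apply: (mulfI k2); rewrite -KE krawtchoukSS // -/(K _) -/(K _) !KE.
  rewrite [RHS](_ : _ = ((2 * e - k.+1%:R * (q - p) / a) * L k.+1
   - k.+1%:R * (2 - k%:R * (p * q) * a^-1 ^+ 2) * L k) * (k.+2%:R * s k.+2));
    last by ring.
  have e1 : a * s k.+1 * k.+1%:R = a ^+ 2 * s k.
    by rewrite -mulrA [_ * k.+1%:R]mulrC sS; ring.
  have an0 : a != 0 by rewrite gt_eqF.
  rewrite sS.
  have pqN : p * q * N%:R = 2 * a ^+ 2 by rewrite a2; field.
  have -> : ((2 * e - k.+1%:R * (q - p) / a) * L k.+1
   - k.+1%:R * (2 - k%:R * (p * q) * a^-1 ^+ 2) * L k) * (a * s k.+1) =
   (2 * a * e - k.+1%:R * (q - p)) * L k.+1 * s k.+1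
   - (2 - k%:R * (p * q) * a^-1 ^+ 2) * L k * (a * s k.+1 * k.+1%:R).
    by field.
  rewrite e1 [p * q * (_ - _)]mulrBr pqN.
  by field.
move=> hm _; rewrite -/(K m) KE -/(s m).
rewrite (_ : _ - _ = (L m - hermite m e) * s m); last by ring.
rewrite normrM (gtr0_norm (s0 m)) ler_wpM2r ?(ltW (s0 m)) //.
by move: hm; rewrite (gtr0_norm (_ : 0 < a^-1)) ?invr_gt0.
Qed.

(** Identifies x - p N = eta sqrt (2 p q / N) N with 2 a eta, where
    a = sqrt (p q N / 2). *)
Lemma sqrt_rescale (R : realType) (p q : R) (N : nat) :
  0 <= p * q -> (0 < N)%N ->
  Num.sqrt (2 * p * q * N%:R^-1) * N%:R = 2 * Num.sqrt (p * q / 2 * N%:R).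
Proof.
move=> pq0 N0; have N0' : N%:R != 0 :> R by rewrite pnatr_eq0 -lt0n.
rewrite -[2 * p * q]mulrA; move: (p * q) pq0 => w w0.
have sqr (z : R) : 0 <= z -> z = Num.sqrt (z ^+ 2).
  by move=> z0; rewrite sqrtr_sqr ger0_norm.
rewrite [X in _ * X = _](sqr N%:R) // [X in _ = X * _](sqr 2) //.
rewrite -!sqrtrM ?mulr_ge0 ?invr_ge0 //.
by congr Num.sqrt; field.
Qed.

Lemma powR_half_scale (R : realType) (s : R) (N n : nat) :
  0 <= s -> (0 < N)%N ->
  (N%:R^-1) `^ (- (n%:R / 2)) * s `^ (n%:R / 2)
  = Num.sqrt (s * N%:R) ^+ n.
Proof.
move=> s0 N0.
have -> : (N%:R^-1 : R) `^ (- (n%:R / 2)) = N%:R `^ (n%:R / 2).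
  by rewrite powRN -(powR_inv1 (ler0n R N)) -powRrM mulN1r powRN invrK.
rewrite -powRM // [n%:R / 2]mulrC powRrM mulrC powR12_sqrt ?mulr_ge0 //.
by rewrite powR_mulrn.
Qed.

Theorem mainTheorem2 (R : realType) (p q : R)
    (hp : 0 < p < 1) (hq : 0 < q < 1) (hpq : p + q = 1)
    (n : nat -> nat) (eta : nat -> R)
    (hn : (fun N : nat => (n N)%:R : R) =O_\oo (fun=> 1 : R))
    (heta : eta =O_\oo (fun=> 1 : R)) :
  let eps := fun N : nat => (N%:R : R)^-1 in
  let y := fun N : nat => p + eta N * Num.sqrt (2 * p * q * eps N) in
  let x := fun N : nat => y N * N%:R in
  let K := fun N : nat => krawtchouk (n N) N p q (x N) in
  let scale := fun N : nat =>
    eps N `^ (- ((n N)%:R / 2)) / (n N)`!%:R * (p * q / 2) `^ ((n N)%:R / 2) in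
  let H := fun N : nat => hermite (n N) (eta N) in
  K = (fun N : nat => scale N * H N) +o_\oo scale /\
  (forall delta : R, 0 < delta -> (\forall N \near \oo, delta <= `|H N|) ->
    K ~_\oo (fun N : nat => scale N * H N)).
Proof.
move=> eps y x K scale H.
have p0 : 0 < p by case/andP: hp.
have q0 : 0 < q by case/andP: hq.
have pq0 : 0 < p * q by rewrite mulr_gt0.
suff Herr e : 0 < e ->
    \forall N \near \oo, `|K N - scale N * H N| <= e * `|scale N|.
  split; first by apply/eqaddoP => e e0; apply: Herr.
  move=> delta d0 Hd; apply/eqaddoP => e e0.
  have := Herr (e * delta) (mulr_gt0 e0 d0); apply: filterS2 Hd => N Hd hK.
  apply: le_trans hK _; rewrite /= (normrM (scale N) (H N)) -mulrA (ler_pM2l e0).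
  by rewrite mulrC ler_wpM2l.
move=> e0.
have [B B0 HB] := (eqO_exP _ _ _).1 heta.
have [D D0 HD] := (eqO_exP _ _ _).1 hn.
have [C C0 HC] := krawtchouk_hermite_error B (Num.bound D) p0 q0 hpq.
near=> N.
have N0 : (0 < N)%N by near: N; exact: nbhs_infty_gt.
pose a := Num.sqrt (p * q / 2 * N%:R).
have pqN : 0 <= p * q / 2 * N%:R by rewrite !mulr_ge0 // ltW.
have a2 : a ^+ 2 = p * q / 2 * N%:R by rewrite sqr_sqrtr.
(* This one lower bound gives both 1 <= a and C / a <= e *)
have a1 : 1 + C / e <= a.
  rewrite -[leLHS]ger0_norm ?addr_ge0 ?divr_ge0 ?(ltW e0) //.
  rewrite -sqrtr_sqr ler_wsqrtr // -ler_pdivrMl ?divr_gt0 //.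
  by near: N; exact: nbhs_infty_ger.
have Ce : 0 <= C / e by rewrite divr_ge0 // ltW.
have a0 : 0 < a by lra.
have nM : (n N <= Num.bound D)%N.
  rewrite -(ler_nat R) ltW //; apply: le_lt_trans (archi_boundP (ltW D0)).
  rewrite -[leLHS]ger0_norm // -[leRHS]mulr1 -[X in _ * X]normr1.
  by near: N; exact: HD.
have etaB : `|eta N| <= B.
  by rewrite -[leRHS]mulr1 -[X in _ * X]normr1; near: N; exact: HB.
have xE : x N = p * N%:R + 2 * a * eta N.
  by rewrite /x /y mulrDl -mulrA sqrt_rescale ?(ltW pq0) // [eta N * _]mulrC.
have sE : scale N = a ^+ n N / (n N)`!%:R.
  by rewrite /scale mulrAC powR_half_scale // divr_ge0 // ltW.
have := HC N (eta N) etaB a a2 _ (n N) nM.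
rewrite /K xE sE /H => hK; apply: le_trans (hK _) _; first lra.
rewrite ger0_norm ?divr_ge0 ?exprn_ge0 ?(ltW a0) //.
rewrite ler_wpM2r ?divr_ge0 ?exprn_ge0 ?(ltW a0) //.
by rewrite ler_pdivrMr // mulrC -ler_pdivrMr //; lra.
Unshelve. all: by end_near.
Qed.
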